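(* Let $n$ be a positive integer, let $1\le s\le \lfloor n/2\rfloor$, and let $I=J(G)$ be the cover ideal of the circulant graph $G=C_n(1,2,\dots,s)$. Let $G_1$ be the induced subgraph of $G$ on the set of vertices that are different from $x_1$ and not adjacent to $x_1$. The following conditions are equivalent: (1) $I$ is equigenerated. (2) $I$ is quasi-equigenerated. (3) $J(G_1)$ is equigenerated. (4) Either $s\ge \frac{n-2}{3}$ or $s=\frac{n-3}{4}$.
   Context: All graphs are finite and simple. The circulant graph $C_n(1,2,\dots,s)$ has vertex set $\{x_1,\dots,x_n\}$ and edges $\{x_i,x_{i+j}\}$ for $j\in\{\pm1,\dots,\pm s\}$, indices taken modulo $n$. For a graph $G$ with vertices $x_1,\dots,x_n$ (identified with the variables of $R=k[x_1,\dots,x_n]$, $k$ a field) and edge set $E$, the cover ideal is $J(G)=\bigcap_{\{x_i,x_j\}\in E}(x_i,x_j)\subseteq R$. A monomial ideal $I$ of $R$ with minimal monomial generators $f_1,\dots,f_t$, $f_j=\prod_{i=1}^n x_i^{c_{ij}}$, is quasi-equigenerated if there is $\alpha=(a_1,\dots,a_n)$ with all $a_i$ positive integers such that $d_\alpha(f_j):=\sum_{i=1}^n a_i c_{ij}$ is the same for all $j$; it is equigenerated if this holds with $\alpha=(1,\dots,1)$, i.e. all minimal generators have the same degree. By convention, the cover ideal of a graph without edges (including the graph with no vertices) is equigenerated. *)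

(* Defs.v *)
From HB Require Import structures.
From mathcomp Require Import all_boot all_order all_algebra.
From mathcomp Require Export mpoly.

Set Implicit Arguments.
Unset Strict Implicit.
Unset Printing Implicit Defensive.

Import GRing.Theory.
Local Open Scope ring_scope.

Record sgraph (n : nat) := SGraph {
  adj : rel 'I_n;
  adj_sym : ssrbool.symmetric adj;
  adj_irr : irreflexive adj
}.

Definition circulant_adj (n s : nat) : rel 'I_n := fun u v =>
  (u != v) && [exists d : 'I_s.+1, (0 < d)%N &&
    ((v == u + d %[mod n])%N || (u == v + d %[mod n])%N)].

Lemma circulant_sym (n s : nat) : ssrbool.symmetric (@circulant_adj n s).
Proof.
move=> u v; rewrite /circulant_adj eq_sym; congr (_ && _).
by apply: eq_existsb => d; rewrite orbC.
Qed.

Lemma circulant_irr (n s : nat) : irreflexive (@circulant_adj n s).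
Proof. by move=> u; rewrite /circulant_adj eqxx. Qed.

(* C_n(1, ..., s); the paper's vertex x_i is the element i - 1 of 'I_n. The
   clause u != v above is only needed to exclude loops when s >= n. *)
Definition circulant (n s : nat) : sgraph n :=
  SGraph (@circulant_sym n s) (@circulant_irr n s).

Definition induced_adj (n : nat) (G : sgraph n) (A : {set 'I_n}) :
  rel 'I_#|A| := fun i j => adj G (enum_val i) (enum_val j).

Lemma induced_sym (n : nat) (G : sgraph n) (A : {set 'I_n}) :
  ssrbool.symmetric (induced_adj G (A := A)).
Proof. by move=> i j; rewrite /induced_adj adj_sym. Qed.

Lemma induced_irr (n : nat) (G : sgraph n) (A : {set 'I_n}) :
  irreflexive (induced_adj G (A := A)).
Proof. by move=> i; rewrite /induced_adj adj_irr. Qed.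

(* The vertices of A are relabelled increasingly by 'I_#|A|, so that the cover
   ideal of the induced subgraph lives in a polynomial ring whose variables are
   the vertices of A only. *)
Definition induced (n : nat) (G : sgraph n) (A : {set 'I_n}) : sgraph #|A| :=
  SGraph (@induced_sym n G A) (@induced_irr n G A).

Definition non_neighbours (n : nat) (G : sgraph n) (v : 'I_n) : {set 'I_n} :=
  [set u | (u != v) && ~~ adj G v u].

Section Ideals.
Variables (k : fieldType) (n : nat).
Implicit Types (I : {mpoly k[n]} -> Prop) (ms : seq 'X_{1..n}).

Definition ideal_gen (gs : seq {mpoly k[n]}) : {mpoly k[n]} -> Prop :=
  fun p => exists c : 'I_(size gs) -> {mpoly k[n]},
    p = \sum_(i < size gs) c i * gs`_i.

(* For a graph without edges the intersection is empty, hence the unit ideal,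
   with minimal generator 1. *)
Definition cover_ideal (G : sgraph n) : {mpoly k[n]} -> Prop :=
  fun p => forall i j : 'I_n, adj G i j -> ideal_gen [:: 'X_i; 'X_j] p.

Definition monomial_gens I ms :=
  forall p : {mpoly k[n]}, I p <-> ideal_gen [seq 'X_[m] | m <- ms] p.

Definition min_monomial_gens I ms :=
  [/\ uniq ms, monomial_gens I ms
    & forall ms', {subset ms' <= ms} -> monomial_gens I ms' ->
        {subset ms <= ms'}].

Definition wdeg (a : 'I_n -> nat) (m : 'X_{1..n}) : nat :=
  (\sum_(i < n) a i * m i)%N.

Definition equigenerated_for (a : 'I_n -> nat) I :=
  exists2 ms, min_monomial_gens I ms
    & {in ms &, forall f g, wdeg a f = wdeg a g}.

Definition quasi_equigenerated I :=
  exists2 a : 'I_n -> nat, forall i, (0 < a i)%N & equigenerated_for a I.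

Definition equigenerated I := equigenerated_for (fun _ => 1%N) I.

End Ideals.

Arguments cover_ideal k {n} G.

(* Main.v *)
Require Import Defs.
From mathcomp Require Import all_boot all_order all_algebra.
From mathcomp Require Import zify ring lra.
Import GRing.Theory Num.Theory.

Set Implicit Arguments.
Unset Strict Implicit.
Unset Printing Implicit Defensive.

Local Open Scope ring_scope.

(* The minimal generators of J(G) are the squarefree monomials of the complements
   of the maximal independent sets of G, so J(G) is equigenerated for weights a
   iff all maximal independent sets have the same a-weight; in particular
   "equigenerated" means that G is well-covered. The maximal independent sets of
   G_1 are those of G through x_1, with x_1 removed.
   A maximal independent set F of C_n(1,...,s) satisfies
   |F|(s+1) <= n <= |F|(2s+1), which determines |F| when n <= 3s+2 or n = 4s+3.
   Otherwise some L in [3s+3, 4s+2] has L = n or L + s < n, and in a maximal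
   independent set through 0, 2s+1 and L mod n one may replace 2s+1 by the two
   vertices s+1 and 2s+2. *)

(** * Membership in monomial ideals *)

Section MonomialIdeals.
Variables (k : fieldType) (n : nat).
Implicit Types (gs : seq {mpoly k[n]}) (p q : {mpoly k[n]}).
Implicit Types (ms : seq 'X_{1..n}) (I : {mpoly k[n]} -> Prop).

Lemma ideal_genD gs p q :
  ideal_gen gs p -> ideal_gen gs q -> ideal_gen gs (p + q).
Proof.
move=> [c ->] [d ->]; exists (fun i => c i + d i).
by rewrite -big_split; apply: eq_bigr => i _; rewrite mulrDl.
Qed.

Lemma ideal_genMl gs p q : ideal_gen gs q -> ideal_gen gs (p * q).
Proof.
move=> [c ->]; exists (fun i => p * c i).
by rewrite mulr_sumr; apply: eq_bigr => i _; rewrite mulrA.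
Qed.

Lemma ideal_gen0 gs : ideal_gen gs 0.
Proof. by exists (fun=> 0); rewrite big1 // => i _; rewrite mul0r. Qed.

Lemma mem_ideal_gen gs p : p \in gs -> ideal_gen gs p.
Proof.
move=> pgs; have lt_p : (index p gs < size gs)%N by rewrite index_mem.
exists (fun i => (i == Ordinal lt_p)%:R).
rewrite (bigD1 (Ordinal lt_p)) //= eqxx mul1r nth_index // big1 ?addr0 //.
by move=> i /negPf ->; rewrite mul0r.
Qed.

Lemma ideal_gen_monomials ms p :
  ideal_gen [seq 'X_[m] | m <- ms] p <->
  {in msupp p, forall m, has (fun m' => (m' <= m)%MM) ms}.
Proof.
split=> [[c ->] m /msupp_sum_le/flatten_mapP [i _] | ms_p].
  have lt_i : (i < size ms)%N by rewrite -(size_map (fun m => 'X_[k, m])).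
  rewrite (nth_map 0%MM) // (perm_mem (msuppMX _ _)) => /mapP [m' _ ->].
  by apply/hasP; exists (nth 0%MM ms i); rewrite ?mem_nth // lem_addr.
rewrite [p]mpolyE big_seq.
apply: big_ind => [|q r|m /ms_p /hasP [m' ms_m' le_m]].
- exact: ideal_gen0.
- exact: ideal_genD.
rewrite -mul_mpolyC -(submK le_m) mpolyXD mulrA; apply: ideal_genMl.
exact/mem_ideal_gen/map_f.
Qed.

(** Two ideals, each cut out by a condition on supports, agree as soon as they contain the same
    monomials; this turns generation into divisibility. *)
Lemma monomial_gensP (S : pred 'X_{1..n}) I ms :
    (forall p, I p <-> {in msupp p, forall m, S m}) ->
  monomial_gens I ms <-> S =1 (fun m => has (fun m' => (m' <= m)%MM) ms).
Proof.
move=> IP; split=> [gens m | S_ms p]; last first.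
  by rewrite ideal_gen_monomials IP; split=> h m /h; rewrite S_ms.
have supp1 (Q : pred 'X_{1..n}) :
    {in msupp ('X_[m] : {mpoly k[n]}), forall m', Q m'} <-> Q m.
  by split=> [|Qm m' /mem_msuppXP <-]; first by apply; apply/mem_msuppXP.
by apply/idP/idP=> [/supp1/IP/gens/ideal_gen_monomials/supp1
                   |/supp1/ideal_gen_monomials/gens/IP/supp1].
Qed.

End MonomialIdeals.

(** * Cover ideals and maximal independent sets *)

Section CoverIdeals.
Variables (n : nat) (G : sgraph n).
Implicit Types (F H : {set 'I_n}) (m : 'X_{1..n}).

Definition indep F := [forall u in F, forall v in F, ~~ adj G u v].

Lemma indepP F : reflect {in F &, forall u v, ~~ adj G u v} (indep F).
Proof.
apply: (iffP forall_inP) => [h u v /h/forall_inP | h u uF]; first exact.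
by apply/forall_inP => v; apply: h.
Qed.

Lemma indepS F H : F \subset H -> indep H -> indep F.
Proof.
move=> /subsetP sFH /indepP iH.
by apply/indepP => u v /sFH uH /sFH; apply: iH.
Qed.

Definition max_indep F := maxset indep F.

Definition well_covered :=
  forall F H, max_indep F -> max_indep H -> #|F| = #|H|.

Definition cover_monomial F : 'X_{1..n} :=
  [multinom (i \notin F : nat) | i < n].

(** Adjoint to [cover_monomial] for divisibility and inclusion; a monomial lies in J(G) exactly when
    this set is independent. *)
Definition uncovered m : {set 'I_n} := [set i | m i == 0%N].

Lemma uncovered_cover_monomial F : uncovered (cover_monomial F) = F.
Proof. by apply/setP => i; rewrite inE mnmE eqb0 negbK. Qed.

Lemma cover_monomial_le F m :
  (cover_monomial F <= m)%MM = (uncovered m \subset F).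
Proof.
apply/mnm_lepP/subsetP=> [h i | h i].
  by move: (h i); rewrite inE mnmE; case: (i \in F) => //=; case: (m i).
by rewrite mnmE; move: (h i); rewrite inE; case: (i \in F); case: (m i) => //= /(_ isT).
Qed.

Lemma le_uncovered m m' : (m <= m')%MM -> uncovered m' \subset uncovered m.
Proof.
by move/mnm_lepP=> h; apply/subsetP=> i; rewrite !inE -!leqn0; apply: leq_trans.
Qed.

Lemma le_cover_monomial F m :
  (m <= cover_monomial F)%MM -> uncovered m \subset F -> m = cover_monomial F.
Proof.
rewrite -cover_monomial_le => /mnm_lepP h /mnm_lepP h'.
by apply/mnmP=> i; apply/eqP; rewrite eqn_leq h h'.
Qed.

(** Equal weighted degrees thus amount to equal weights of the complementary sets; the additive form
    allows cancellation in [nat]. *)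
Lemma wdeg_cover_monomial a F :
  (wdeg a (cover_monomial F) + \sum_(i in F) a i = \sum_i a i)%N.
Proof.
rewrite /wdeg [RHS](bigID (mem F)) /= addnC; congr addn.
rewrite [RHS]big_mkcond; apply: eq_bigr => i _.
by rewrite mnmE; case: (i \in F); rewrite /= ?muln0 ?muln1.
Qed.

Variable k : fieldType.

Lemma cover_idealP (p : {mpoly k[n]}) :
  cover_ideal k G p <-> {in msupp p, forall m, indep (uncovered m)}.
Proof.
have gen2 i j := ideal_gen_monomials [:: U_(i)%MM; U_(j)%MM] p.
split=> [h m pm | h i j ij].
  apply/indepP => i j; rewrite !inE => mi0 mj0; apply/negP => /h.
  by case/gen2/(_ m pm)/hasP => _ /[!inE] /pred2P [] ->; rewrite lep1mP ?mi0 ?mj0.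
apply/gen2 => m /h/indepP/(_ i j); rewrite /= !lep1mP !inE orbF.
by case: (m i == _) => //; case: (m j == _) => // /(_ isT isT); rewrite ij.
Qed.

Lemma cover_ideal_gens (ms : seq 'X_{1..n}) :
  monomial_gens (cover_ideal k G) ms <->
  (fun m => indep (uncovered m)) =1 (fun m => has (fun m' => (m' <= m)%MM) ms).
Proof. exact/monomial_gensP/cover_idealP. Qed.

(** A generator dividing [cover_monomial F] has an independent uncovered set containing [F], hence
    equal to [F] by maximality, so it is [cover_monomial F] itself. *)
Lemma max_indep_gens (ms : seq 'X_{1..n}) F :
  monomial_gens (cover_ideal k G) ms -> max_indep F -> cover_monomial F \in ms.
Proof.
move=> /cover_ideal_gens gens maxF.
have := maxsetp maxF; rewrite -{1}[F]uncovered_cover_monomial (gens _).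
case/hasP => m ms_m le_m.
have uF : uncovered m = F.
  apply: (maxsetsup maxF); first by rewrite (gens m); apply/hasP; exists m; rewrite ?lepm_refl.
  by rewrite -{1}[F]uncovered_cover_monomial le_uncovered.
by rewrite -(le_cover_monomial le_m) ?uF.
Qed.

Lemma equigenerated_forP (a : 'I_n -> nat) :
  equigenerated_for a (cover_ideal k G) <->
  (forall F H, max_indep F -> max_indep H ->
    (\sum_(i in F) a i = \sum_(i in H) a i)%N).
Proof.
split=> [[ms [_ gens _] eq_ms] F H maxF maxH | eq_a].
  have := eq_ms _ _ (max_indep_gens gens maxF) (max_indep_gens gens maxH).
  have := wdeg_cover_monomial a F; rewrite -(wdeg_cover_monomial a H) => + eqFH.
  by rewrite eqFH => /addnI.
(* These monomials generate because every independent set extends to a maximal one; they are minimal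
   because [max_indep_gens] puts them in every generating family. *)
exists [seq cover_monomial F | F <- enum max_indep].
  split.
  - by rewrite map_inj_uniq ?enum_uniq //; apply: can_inj uncovered_cover_monomial.
  - apply/cover_ideal_gens => m.
    apply/idP/hasP => [/maxset_exists [F maxF sF] | [_ /mapP [F + ->]]].
      exists (cover_monomial F); last by rewrite cover_monomial_le.
      by rewrite map_f // mem_enum.
    rewrite mem_enum cover_monomial_le => maxF sF.
    exact: indepS sF (maxsetp maxF).
  - move=> ms' _ gens' _ /mapP [F + ->]; rewrite mem_enum => maxF.
    exact: max_indep_gens gens' maxF.
move=> _ _ /mapP [F + ->] /mapP [H + ->]; rewrite !mem_enum => maxF maxH.
have := wdeg_cover_monomial a F; rewrite -(wdeg_cover_monomial a H).
by rewrite (eq_a F H) // => /addIn.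
Qed.

Lemma equigeneratedP : equigenerated (cover_ideal k G) <-> well_covered.
Proof.
rewrite /equigenerated equigenerated_forP.
by split=> h F H maxF maxH; move: (h F H maxF maxH); rewrite !sum1_card.
Qed.

End CoverIdeals.

(** * Independent sets through a fixed vertex *)

Section Link.
Variables (n : nat) (G : sgraph n) (v : 'I_n).
Let A := non_neighbours G v.
Let G1 := induced G A.
Implicit Types (F : {set 'I_#|A|}) (H : {set 'I_n}).

(** The independence complex of [G1] is the link of [v] in that of [G]; this sends a face of the
    link to the corresponding face through [v]. *)
Definition link F : {set 'I_n} := v |: enum_val @: F.

Lemma link_inP F u :
  reflect (u = v \/ exists2 i, i \in F & u = enum_val i) (u \in link F).
Proof.
rewrite in_setU1; apply: (iffP orP) => -[/eqP|/imsetP]; by [left | right].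
Qed.

Lemma card_link F : #|link F| = #|F|.+1.
Proof.
rewrite cardsU1 card_imset; last exact: enum_val_inj.
have -> // : v \notin enum_val @: F.
apply/imsetP => -[i _ vi]; have := enum_valP i.
by rewrite -vi inE eqxx.
Qed.

Lemma linkS F F' : (link F \subset link F') = (F \subset F').
Proof.
apply/idP/idP => [/subsetP s | s]; last by rewrite setUS ?imsetS.
apply/subsetP => i iF.
have /s/link_inP [vi|[j jF /enum_val_inj -> //]] : enum_val i \in link F.
  by apply/link_inP; right; exists i.
by have := enum_valP i; rewrite vi inE eqxx.
Qed.

Lemma indep_link F : indep G (link F) = indep G1 F.
Proof.
have nadj (i : 'I_#|A|) : ~~ adj G v (enum_val i).
  by have := enum_valP i; rewrite inE => /andP [].
apply/indepP/indepP => [h i j iF jF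
  | h i j /link_inP [->|[i' i'F ->]] /link_inP [->|[j' j'F ->]]].
- by apply: h; apply/link_inP; right; [exists i | exists j].
- by rewrite adj_irr.
- exact: nadj.
- by rewrite adj_sym.
- exact: h.
Qed.

Lemma linkK H : indep G H -> v \in H -> link (enum_val @^-1: H) = H.
Proof.
move=> /indepP iH vH; apply/setP => u.
apply/link_inP/idP => [[->//|[i + ->]] | uH]; first by rewrite inE.
have [->|neq] := eqVneq u v; [by left | right].
have uA : u \in A by rewrite inE neq iH.
by exists (enum_rank_in uA u); rewrite ?inE enum_rankK_in.
Qed.

(** [link] is an inclusion-preserving bijection onto the independent sets through [v], and any set
    containing [link F] still contains [v]. *)
Lemma max_indep_link F : max_indep G (link F) <-> max_indep G1 F.
Proof.
split=> /maxsetP [iF maxF]; apply/maxsetP; split; rewrite ?indep_link // in iF *.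
  move=> F' iF' sFF'; apply/eqP; rewrite eqEsubset sFF' andbT -linkS.
  by rewrite (maxF (link F')) ?linkS ?indep_link.
move=> H iH sFH; have vH : v \in H by apply: (subsetP sFH); apply/link_inP; left.
have eH := linkK iH vH; move: iH sFH; rewrite -eH linkS indep_link => iH /maxF -> //.
Qed.

Lemma well_covered_link :
  well_covered G1 <->
  (forall H K, max_indep G H -> max_indep G K -> v \in H -> v \in K ->
    #|H| = #|K|).
Proof.
have vlink F : v \in link F by apply/link_inP; left.
split=> h F H maxF maxH.
  move=> vF vH.
  have [eF eH] := (linkK (maxsetp maxF) vF, linkK (maxsetp maxH) vH).
  rewrite -eF -eH !card_link; congr _.+1.
  by apply: h; apply/max_indep_link; rewrite ?eF ?eH.
by apply: succn_inj; rewrite -!card_link; apply: h => //; apply/max_indep_link.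
Qed.

End Link.

(** * Automorphisms and domination *)

Lemma max_indep_imset n (G : sgraph n) (f : 'I_n -> 'I_n) (F : {set 'I_n}) :
    injective f -> (forall u v, adj G (f u) (f v) = adj G u v) ->
  max_indep G F -> max_indep G (f @: F).
Proof.
move=> f_inj f_adj /maxsetP [/indepP iF maxF]; apply/maxsetP.
split=> [|H /indepP iH sFH].
  by apply/indepP => _ _ /imsetP [u uF ->] /imsetP [v vF ->]; rewrite f_adj iF.
(* An injection of a finite set into itself is onto, so the larger set [H] pulls back without
   loss. *)
have fK : f @: (f @^-1: H) = H.
  by apply/setP => u; rewrite -(f_invF f_inj u) mem_imset // inE.
rewrite -fK (maxF (f @^-1: H)) //; last by rewrite -sub_imset_pre.
by apply/indepP => u v; rewrite !inE -f_adj; apply: iH.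
Qed.

Lemma max_indep_dominates n (G : sgraph n) (F : {set 'I_n}) w :
  max_indep G F -> exists2 u, u \in F & (w == u) || adj G u w.
Proof.
move=> /maxsetP [/indepP iF maxF]; apply/exists_inP; apply: contraT.
rewrite negb_exists_in => /forall_inP h.
have wF : w \in F; last by have := h w wF; rewrite eqxx.
rewrite -(maxF (w |: F)) ?setU11 ?subsetUr //; apply/indepP => u v.
rewrite !in_setU1 => /predU1P [->|uF] /predU1P [->|vF].
- by rewrite adj_irr.
- by rewrite adj_sym; have := h v vF; rewrite negb_or => /andP [].
- by have := h u uF; rewrite negb_or => /andP [].
- exact: iF.
Qed.

(** * Maximal independent sets of circulant graphs *)

Section Circulant.
Variables (n s : nat).
Hypothesis s_gt0 : (0 < s)%N.
Hypothesis le_sn : (s <= n %/ 2)%N.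
Let G := circulant n s.
Let lt_sn : (s + s <= n)%N.
Proof. by lia. Qed.

(** The two disjuncts are the two ways around the cycle; with no modulus left, later adjacency
    questions are linear arithmetic. *)
Lemma circulant_adj_lt (u v : 'I_n) : (u < v)%N ->
  adj G u v = (v <= u + s)%N || (u + n <= v + s)%N.
Proof.
move=> lt_uv; have lt_v := ltn_ord v; have lt_u := ltn_ord u.
rewrite /= /circulant_adj -val_eqE /= neq_ltn lt_uv /=.
apply/existsP/orP => [[d /andP [d_gt0 /orP [] /eqP]] | [le | le]].
- have := ltn_ord d; case: (ltnP (u + d) n) => [lt|le] lt_d.
    by rewrite !modn_small //; lia.
  by rewrite -(subnK le) modnDr !modn_small //; lia.
- have := ltn_ord d; case: (ltnP (v + d) n) => [lt|le] lt_d.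
    by rewrite !modn_small //; lia.
  by rewrite -(subnK le) modnDr !modn_small //; lia.
- exists (inord (v - u)); rewrite inordK ?subn_gt0 ?lt_uv //=; last by lia.
  by rewrite subnKC ?eqxx // ltnW.
- exists (inord (u + n - v)); rewrite inordK; last by lia.
  apply/andP; split; first by lia.
  by rewrite subnKC ?modnDr ?eqxx ?orbT //; lia.
Qed.

(** The arcs [u, ..., u + s] starting at the members of [F] are pairwise disjoint. *)
Lemma indep_card_le (F : {set 'I_n}) : indep G F -> (#|F| * s.+1 <= n)%N.
Proof.
move=> /indepP iF.
have n_gt0 : (0 < n)%N by lia.
pose f (x : 'I_n * 'I_s.+1) := Ordinal (ltn_pmod (x.1 + x.2) n_gt0).
have shift (u v : 'I_n) (d e : 'I_s.+1) : u \in F -> v \in F -> (u < v)%N ->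
    f (u, d) != f (v, e).
  move=> uF vF lt_uv; have := iF u v uF vF; rewrite circulant_adj_lt //.
  rewrite -val_eqE /=; have := (ltn_ord d, ltn_ord e) => -[lt_d lt_e] nadj.
  by rewrite eq_sym eqn_mod_dvd ?gtnNdvd; lia.
have f_inj : {in setX F setT &, injective f}.
  move=> [u d] [v e] /setXP [uF _] /setXP [vF _] eqf.
  have [lt|lt|/val_inj eq_uv] := ltngtP u v.
  - by have := shift u v d e uF vF lt; rewrite eqf eqxx.
  - by have := shift v u e d vF uF lt; rewrite eqf eqxx.
  congr pair => //; apply/val_inj; move: eqf => /(congr1 val) /eqP /=.
  rewrite eq_uv eqn_modDl !modn_small; first by move/eqP.
  - by have := ltn_ord e; lia.
  - by have := ltn_ord d; lia.
rewrite -[leqRHS]card_ord -[s.+1]card_ord -cardsT -cardsX -(card_in_imset f_inj).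
exact: max_card.
Qed.

(** By domination, the arcs [u - s, ..., u + s] around the members of [F] cover all vertices. *)
Lemma max_indep_card_ge (F : {set 'I_n}) :
  max_indep G F -> (n <= #|F| * (2 * s).+1)%N.
Proof.
move=> maxF; have n_gt0 : (0 < n)%N by lia.
(* Adding [n - s] subtracts [s] modulo [n], so the offset [s] gives the centre of the arc. *)
pose f (x : 'I_n * 'I_(2 * s).+1) :=
  Ordinal (ltn_pmod (x.1 + x.2 + (n - s)) n_gt0).
rewrite -[_.+1 in leqRHS]card_ord -cardsT -cardsX -[leqLHS]card_ord -cardsT.
apply: leq_trans (leq_imset_card f _); apply/subset_leq_card/subsetP => w _.
have [u uF uw] := max_indep_dominates w maxF.
suff [d eq_w] : exists d : 'I_(2 * s).+1, (u + d + (n - s) = w %[mod n])%N.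
  apply/imsetP; exists (u, d); first by rewrite !inE uF.
  by apply/val_inj; rewrite /= eq_w modn_small.
case/predU1P: uw => [->|/andP [_ /existsP [d /andP [d_gt0 /orP [] /eqP eqd]]]].
- exists (inord s); rewrite inordK; last by lia.
  by rewrite -addnA subnKC ?modnDr //; lia.
- have := ltn_ord d => lt_d; exists (inord (s + d)); rewrite inordK; last by lia.
  have -> : (u + (s + d) + (n - s) = u + d + n)%N by lia.
  by rewrite modnDr eqd.
- have := ltn_ord d => lt_d; exists (inord (s - d)); rewrite inordK; last by lia.
  have -> : (u + (s - d) + (n - s) = u + (n - d))%N by lia.
  rewrite -modnDml eqd modnDml.
  have -> : (w + d + (n - d) = w + n)%N by lia.
  by rewrite modnDr.
Qed.

Lemma circulant_well_covered :
  (n <= 3 * s + 2)%N \/ n = (4 * s + 3)%N -> well_covered G.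
Proof.
move=> hn F H maxF maxH.
have {maxF} := (indep_card_le (maxsetp maxF), max_indep_card_ge maxF).
have {maxH} := (indep_card_le (maxsetp maxH), max_indep_card_ge maxH).
move: #|F| #|H| => a b [ub lb] [ua la].
(* For [n = 4 * s + 3], size 2 covers at most [4 * s + 2] vertices and size 4 requires [4 * s + 4],
   which leaves 3. *)
have k123 c : (c * s.+1 <= n)%N -> (n <= c * (2 * s).+1)%N ->
    c = (if n <= 2 * s + 1 then 1 else if n <= 3 * s + 2 then 2 else 3)%N.
  by move=> uc lc; case: ifP; [|case: ifP]; nia.
by rewrite (k123 a) // (k123 b).
Qed.

Lemma circulant_not_well_covered (v : 'I_n) : v = 0 :> nat ->
    (3 * s + 3 <= n)%N -> n != (4 * s + 3)%N ->
  exists F H : {set 'I_n}, [/\ max_indep G F, max_indep G H,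
    v \in F, v \in H & #|F| != #|H|].
Proof.
move=> v0 n_ge n_neq.
have n_gt0 : (0 < n)%N by lia.
have [L [L_ge L_le L_n]] :
    exists L, [/\ 3 * s + 3 <= L, L <= 4 * s + 2 & L = n \/ L + s < n]%N.
  (* In the second case [n >= 4 * s + 4], as [n] is not [4 * s + 3], so [L + s = 4 * s + 3 < n]. *)
  exists (if n <= 4 * s + 2 then n else 3 * s + 3)%N.
  by case: ifP => h; split; lia.
have [l l_val] : exists l : 'I_n,
    (L = n /\ l = 0 :> nat) \/ (L + s < n /\ l = L :> nat)%N.
  exists (Ordinal (ltn_pmod L n_gt0)) => /=.
  case: L_n => [->|lt]; first by left; rewrite modnn.
  by right; rewrite modn_small //; lia.
have lt1 : (2 * s + 1 < n)%N by lia.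
have lt2 : (s + 1 < n)%N by lia.
have lt3 : (2 * s + 2 < n)%N by lia.
pose x := Ordinal lt1; pose y := Ordinal lt2; pose z := Ordinal lt3.
have indep_lt (F : {set 'I_n}) :
    {in F &, forall u w : 'I_n,
      (u < w)%N -> (u + s < w)%N && (w + s < u + n)%N} <->
    indep G F.
  split=> [h | /indepP h u w uF wF lt].
    apply/indepP => u w uF wF; have [lt|lt|/val_inj ->] := ltngtP u w.
    - by have := h u w uF wF lt; rewrite circulant_adj_lt //; lia.
    - by have := h w u wF uF lt; rewrite adj_sym circulant_adj_lt //; lia.
    - by rewrite adj_irr.
  by have := h u w uF wF; rewrite circulant_adj_lt //; lia.
have [|F maxF sF] := @maxset_exists _ (indep G) [set v; x; l].
  apply/indep_lt => u w; rewrite !inE -!orbA.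
  by move=> /or3P [] /eqP -> /or3P [] /eqP -> /=; lia.
have [vF xF lF] : [/\ v \in F, x \in F & l \in F].
  by split; apply: (subsetP sF); rewrite !inE eqxx ?orbT.
have iF := (indep_lt F).2 (maxsetp maxF).
(* The vertices strictly between 0 and [L] other than [2 * s + 1] are within [s] of 0, of
   [2 * s + 1] or of [L]; [L <= 4 * s + 2] ensures that none is missed. *)
have F_gap w : w \in F -> w != x -> w = 0 :> nat \/ (L <= w)%N.
  rewrite -val_eqE /= => wF wx; have := ltn_ord w.
  move: (iF v w vF wF) (iF x w xF wF) (iF w x wF xF) (iF w l wF lF) => /=.
  by lia.
(* Here 0, [s + 1], [2 * s + 2] are spaced by [s + 1], and [L >= 3 * s + 3] keeps the next member
   far enough away. *)
pose H := y |: (z |: (F :\ x)).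
have iH : indep G H.
  apply/indep_lt => u w; rewrite !inE.
  case/or3P=> [/eqP -> | /eqP -> | /andP [ux uF]];
  case/or3P=> [/eqP -> | /eqP -> | /andP [wx wF]]; rewrite /=; try lia.
  - by have := F_gap w wF wx; have := ltn_ord w; lia.
  - by have := F_gap w wF wx; have := ltn_ord w; lia.
  - by have := F_gap u uF ux; have := ltn_ord u; lia.
  - by have := F_gap u uF ux; have := ltn_ord u; lia.
  - exact: iF.
have yz : y \notin z |: (F :\ x).
  rewrite !inE -!val_eqE /=; apply/negP => /orP [|/andP [_ yF]]; first by lia.
  by have := F_gap y yF; rewrite -val_eqE /=; lia.
have zF : z \notin F :\ x.
  rewrite !inE -!val_eqE /=; apply/negP => /andP [zx zF].
  by have := F_gap z zF zx => /=; lia.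
have cardH : #|H| = #|F|.+1.
  by rewrite /H !cardsU1 yz zF (cardsD1 x F) xF !add1n.
(* [H] need not be maximal, but enlarging it only widens the difference in size. *)
have [H' maxH' sH] := maxset_exists iH.
exists F, H'; split=> //.
  apply: (subsetP sH); rewrite !inE vF andbT -!val_eqE /= v0.
  by rewrite !addn1 /= !orbT.
by rewrite neq_ltn -cardH subset_leq_card.
Qed.

End Circulant.

(* Averaging the weighted equality over all rotations replaces the weights by
   their mean. *)
Lemma circulant_quasi_equigenerated (k : fieldType) (n s : nat) :
    (0 < n)%N ->
  quasi_equigenerated (cover_ideal k (circulant n s)) ->
  well_covered (circulant n s).
Proof.
case: n => // n _ [a a_gt0 /equigenerated_forP eq_a] F H maxF maxH.
have rot_adj r (u v : 'I_n.+1) :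
    adj (circulant n.+1 s) (u + r) (v + r) = adj (circulant n.+1 s) u v.
  rewrite /= /circulant_adj (inj_eq (addIr r)); congr (_ && _).
  apply: eq_existsb => d /=.
  rewrite !modn_mod ![((_ %% _) + d)%N]addnC !modnDmr !addnA !eqn_modDr.
  by rewrite ![(d + _)%N]addnC.
(* Each rotation of [K] is maximal independent and so weighs as much as [F]; over all rotations,
   each member of [K] meets every weight once. *)
have avg K : max_indep (circulant n.+1 s) K ->
    (n.+1 * \sum_(i in F) a i = #|K| * \sum_i a i)%N.
  move=> maxK.
  transitivity (\sum_(r : 'I_n.+1) \sum_(i in K) a (i + r)%R)%N.
    transitivity (\sum_(r : 'I_n.+1) \sum_(i in F) a i)%N.
      by rewrite sum_nat_const card_ord.
    apply: eq_bigr => r _; rewrite -(@big_imset _ _ _ _ _ (fun i => i + r)) /=;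
      last by move=> ? ? _ _; apply: addIr.
    apply: eq_a => //; apply: max_indep_imset maxK; first exact: addIr.
    exact: rot_adj.
  rewrite exchange_big -sum_nat_const /=; apply: eq_bigr => i _.
  by rewrite [RHS](reindex_inj (addrI i)).
(* A positive total weight can be cancelled from [avg] applied to [F] and to [H]. *)
have a_pos : (0 < \sum_i a i)%N by rewrite (bigD1 ord0) //= addn_gt0 a_gt0.
by apply/eqP; rewrite -(eqn_pmul2r a_pos) -!avg.
Qed.

Theorem theorem3p12 (k : fieldType) (n s : nat) (hn : (0 < n)%N)
    (hs1 : (1 <= s)%N) (hs2 : (s <= n %/ 2)%N) :
  let G := circulant n s in
  let I := cover_ideal k G in
  let x1 : 'I_n := Ordinal hn in
  let G1 := induced G (non_neighbours G x1) in
  [<-> equigenerated I;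
       quasi_equigenerated I;
       equigenerated (cover_ideal k G1);
       ((n%:R - 2) / 3 <= s%:R :> rat) \/ s%:R = (n%:R - 3) / 4 :> rat].
Proof.
move=> G I x1 G1.
have cond4 : ((n%:R - 2) / 3 <= s%:R :> rat) \/ s%:R = (n%:R - 3) / 4 :> rat <->
    (n <= 3 * s + 2)%N \/ n = (4 * s + 3)%N.
  have -> : ((n%:R - 2) / 3 <= s%:R :> rat) = (n <= 3 * s + 2)%N.
    by rewrite ler_pdivrMr // lerBlDr mulrC -(natrM _ 3) -(natrD _ _ 2) ler_nat.
  have eq4 : s%:R = (n%:R - 3) / 4 :> rat <-> n = (4 * s + 3)%N.
    split=> [eq_s | ->]; last by rewrite natrD natrM; field.
    by apply/eqP; rewrite -(eqr_nat rat) natrD natrM; apply/eqP; lra.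
  by rewrite eq4.
tfae.
- by move=> eqI; exists (fun=> 1%N).
- move=> /(circulant_quasi_equigenerated hn) wcG.
  by apply/equigeneratedP/well_covered_link => F H maxF maxH _ _; apply: wcG.
(* The two sets of different sizes both contain [x1], so they already contradict well-coveredness of
   [G1]. *)
- move=> /equigeneratedP/well_covered_link wcG1; apply/cond4.
  have [|lt_n] := leqP n (3 * s + 2); [by left | right].
  apply/eqP; apply: contraT => n_neq.
  have [||F [H [maxF maxH xF xH]]] :=
    @circulant_not_well_covered n s hs1 hs2 x1 _ _ n_neq => //.
    by lia.
  by rewrite (wcG1 F H) ?eqxx.
- by move=> /cond4/(circulant_well_covered hs1 hs2) wcG; apply/equigeneratedP.
Qed.
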